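(* The set $\mathrm{BS}_a(C[0,1],\mathbb{R})$ is not norm-dense in $\mathcal{L}(C[0,1],\mathbb{R})$.
   Context: All Banach spaces are real; $C[0,1]$ has the supremum norm. $S_X$ is the unit sphere of $X$, and $\mathcal{L}(X,Y)$ is the space of bounded linear operators from $X$ to $Y$ with the operator norm, so $\mathcal{L}(X,\mathbb{R})=X^*$. For $T\in\mathcal{L}(X,Y)$ put $M_T=\{x\in S_X:\|Tx\|=\|T\|\}$; $T$ attains its norm if $M_T\neq\emptyset$, and $\mathrm{NA}(X,Y)$ is the set of norm attaining operators. For vectors $x,y$ of a Banach space: $x\perp_B y$ means $\|x\|\le\|x+\lambda y\|$ for all $\lambda\in\mathbb{R}$; $x\perp_S y$ means $\|x\|<\|x+\lambda y\|$ for all $\lambda\in\mathbb{R}\setminus\{0\}$. $\mathrm{BS}_a(X,Y)$ (operators with the adjusted Bhatia-Šemrl property) is the set of $T\in\mathrm{NA}(X,Y)$ such that for every $S\in\mathcal{L}(X,Y)$ with $T\perp_S S$ there is $x_0\in M_T$ with $Tx_0\perp_B Sx_0$. *)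

(* Defs.v *)
From HB Require Import structures.
From mathcomp Require Import all_boot all_order all_algebra.
From mathcomp Require Import all_classical all_reals all_analysis.

Set Implicit Arguments.
Unset Strict Implicit.
Unset Printing Implicit Defensive.

Import Order.TTheory GRing.Theory Num.Theory.
Import numFieldNormedType.Exports.

Local Open Scope classical_set_scope.
Local Open Scope ring_scope.

Section BoundedOperators.
Context {R : realType} {X Y : normedModType R}.

Definition bounded_linear : {pred X -> Y} :=
  mem [set f : X -> Y |
        linear f /\ exists M : R, forall x : X, `|f x| <= M * `|x|].

Lemma bounded_linearP (f : X -> Y) :
  reflect (linear f /\ exists M : R, forall x : X, `|f x| <= M * `|x|)
          (f \in bounded_linear).
Proof. by apply: (iffP idP); rewrite inE. Qed.

Record blop : Type := Blop {
  blop_fun :> X -> Y;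
  blop_subproof : blop_fun \in bounded_linear }.

HB.instance Definition _ := [isSub for blop_fun].
HB.instance Definition _ := [Choice of blop by <:].

Lemma bounded_linear_submod : submod_closed bounded_linear.
Proof.
split.
  have zE x : (0 : X -> Y) x = 0 by [].
  apply/bounded_linearP; split; first by move=> a u v; rewrite !zE scaler0 addr0.
  by exists 0 => x; rewrite zE normr0 mul0r.
move=> a f g /bounded_linearP[lf [M fM]] /bounded_linearP[lg [N gN]].
apply/bounded_linearP; split.
  move=> b u v; rewrite !fctE lf lg !scalerDr !scalerA (mulrC a b).
  by rewrite -!addrA; congr (_ + _); rewrite addrCA.
exists (`|a| * M + N) => x; rewrite !fctE (le_trans (ler_normD _ _))//.
by rewrite mulrDl lerD// normrZ -mulrA ler_wpM2l.
Qed.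

HB.instance Definition _ :=
  GRing.isSubmodClosed.Build R (X -> Y) bounded_linear bounded_linear_submod.
HB.instance Definition _ := [SubChoice_isSubLmodule of blop by <:].

Lemma blop_linear (T : blop) : linear T.
Proof. by have /bounded_linearP[] := blop_subproof T. Qed.

HB.instance Definition _ (T : blop) :=
  GRing.isLinear.Build R X Y _ (blop_fun T) (blop_linear T).

Definition opnorm (T : blop) : R :=
  sup [set `|T x| | x in [set x : X | `|x| <= 1]].

Lemma opnorm_has_sup (T : blop) :
  has_sup [set `|T x| | x in [set x : X | `|x| <= 1]].
Proof.
split; first by exists `|T 0|; exists 0 => //=; rewrite normr0.
have /bounded_linearP[_ [M TM]] := blop_subproof T.
exists `|M| => _ [x /= x1 <-]; rewrite (le_trans (TM x))//.
by rewrite (le_trans (ler_wpM2r _ (ler_norm M)))// ler_piMr.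
Qed.

Lemma ler_opnorm (T : blop) (x : X) : `|T x| <= opnorm T * `|x|.
Proof.
have [->|x0] := eqVneq x 0; first by rewrite linear0 !normr0 mulr0.
have n0 : 0 < `|x| by rewrite normr_gt0.
rewrite -ler_pdivrMr// mulrC -[X in X * _]ger0_norm ?invr_ge0//.
rewrite -normrZ -linearZ; apply: (ub_le_sup (opnorm_has_sup T).2).
by exists (`|x|^-1 *: x) => //=; rewrite normfZV.
Qed.

Lemma opnorm_ge0 (T : blop) : 0 <= opnorm T.
Proof.
apply: (le_trans (normr_ge0 (T 0))); apply: (ub_le_sup (opnorm_has_sup T).2).
by exists 0 => //=; rewrite normr0.
Qed.

Lemma opnorm_le (T : blop) (M : R) :
  (forall x : X, `|x| <= 1 -> `|T x| <= M) -> opnorm T <= M.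
Proof.
move=> TM; apply: ge_sup; first exact: (opnorm_has_sup T).1.
by move=> _ [x /= x1 <-]; exact: TM.
Qed.

Lemma opnormD (S T : blop) : opnorm (S + T) <= opnorm S + opnorm T.
Proof.
apply: opnorm_le => x x1.
rewrite (le_trans (ler_normD _ _))// lerD// (le_trans (ler_opnorm _ _))//.
  by rewrite ler_piMr// opnorm_ge0.
by rewrite ler_piMr// opnorm_ge0.
Qed.

Lemma opnormZ_le (a : R) (T : blop) : opnorm (a *: T) <= `|a| * opnorm T.
Proof.
apply: opnorm_le => x x1; rewrite normrZ ler_wpM2l//.
by rewrite (le_trans (ler_opnorm _ _))// ler_piMr// opnorm_ge0.
Qed.

Lemma opnormZ (a : R) (T : blop) : opnorm (a *: T) = `|a| * opnorm T.
Proof.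
apply/eqP; rewrite eq_le opnormZ_le/=.
have [->|a0] := eqVneq a 0; first by rewrite normr0 mul0r opnorm_ge0.
rewrite -ler_pdivlMl ?normr_gt0// -normfV.
by rewrite (le_trans _ (opnormZ_le _ _))// scalerA mulVf// scale1r.
Qed.

Lemma opnorm0_eq0 (T : blop) : opnorm T = 0 -> T = 0.
Proof.
move=> T0; apply/val_inj/funext => x /=; apply/eqP.
by rewrite -normr_le0 (le_trans (ler_opnorm _ _))// T0 mul0r.
Qed.

HB.instance Definition _ :=
  Lmodule_isNormed.Build R blop opnormD opnormZ opnorm0_eq0.

Lemma blop_normE (T : blop) :
  `|T| = sup [set `|T x| | x in [set x : X | `|x| <= 1]].
Proof. by []. Qed.

End BoundedOperators.
Arguments blop {R} X Y.

(* C[0,1]: an alias of the library type of continuous maps, whose default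
   topology is the compact-open one, equipped here with the supremum norm. *)
Definition C01 (R : realType) : Type := continuousType (`[0, 1]%classic : set R) R^o.

Section C01_normed.
Context {R : realType}.

Definition continuous_pred : {pred (`[0, 1]%classic : set R) -> R^o} :=
  mem [set f | continuous f].

Lemma continuous_predP (f : (`[0, 1]%classic : set R) -> R^o) :
  reflect (continuous f) (f \in continuous_pred).
Proof. by apply: (iffP idP); rewrite inE. Qed.

Definition C01_fun (f : C01 R) : (`[0, 1]%classic : set R) -> R^o :=
  Continuous.sort f.
Coercion C01_fun : C01 >-> Funclass.

Definition C01_Sub (f : (`[0, 1]%classic : set R) -> R^o)
    (cf : f \in continuous_pred) : C01 R :=
  (mkcts (elimT (continuous_predP f) cf) : continuousType _ _).

Lemma C01_Sub_rect (K : C01 R -> Type)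
  (KS : forall f (cf : f \in continuous_pred), K (C01_Sub cf)) u : K u.
Proof.
have cu : C01_fun u \in continuous_pred.
  by apply/continuous_predP; exact: (@cts_fun _ _ u).
by rewrite (_ : u = C01_Sub cu)//; exact/continuousEP.
Qed.

Lemma C01_SubK f (cf : f \in continuous_pred) : C01_fun (C01_Sub cf) = f.
Proof. by []. Qed.

HB.instance Definition _ :=
  isSub.Build _ continuous_pred (C01 R) C01_Sub_rect C01_SubK.
HB.instance Definition _ := [Choice of C01 R by <:].

Lemma continuous_submod : submod_closed continuous_pred.
Proof.
split; first by apply/continuous_predP; exact: (@cst_continuous _ _ (0 : R^o)).
move=> a f g /continuous_predP cf /continuous_predP cg.
apply/continuous_predP => x.
apply: (@cvgD _ R^o _ _ _ (fun t => a *: f t) g _ _ _ (cg x)).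
by apply: (@cvgZl_tmp _ R^o); exact: cf.
Qed.

HB.instance Definition _ :=
  GRing.isSubmodClosed.Build R _ continuous_pred continuous_submod.
HB.instance Definition _ := [SubChoice_isSubLmodule of C01 R by <:].

Definition supnorm (f : C01 R) : R := sup (range (fun t => `|f t|)).

Lemma C01_continuous (f : C01 R) : continuous f.
Proof. exact: (@cts_fun _ _ f). Qed.

Lemma supnorm_has_sup (f : C01 R) : has_sup (range (fun t => `|f t|)).
Proof.
have I0 : (0 : R) \in (`[0, 1]%classic : set R).
  by rewrite inE /= in_itv /= lexx ler01.
split; first by exists `|f (exist _ 0 I0)|, (exist _ 0 I0).
have /(subspace_valL_continuousP _ (f : _ -> R^o)).2 cf :=
  @C01_continuous f.
have [M [Mr fM]] := compact_bounded
  (continuous_compact cf (@segment_compact R 0 1)).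
exists (M + 1) => _ [t _ <-].
apply: (fM (M + 1)); first by rewrite ltrDl.
exists (val t); first exact: set_valP.
by rewrite -[in RHS](@valLK _ _ (point : R^o) _ (f : _ -> R^o)).
Qed.

Lemma ler_supnorm (f : C01 R) t : `|f t| <= supnorm f.
Proof. by apply: (ub_le_sup (supnorm_has_sup f).2); exists t. Qed.

Lemma supnorm_le (f : C01 R) (M : R) :
  (forall t, `|f t| <= M) -> supnorm f <= M.
Proof.
move=> fM; apply: ge_sup; first exact: (supnorm_has_sup f).1.
by move=> _ [t _ <-].
Qed.

Lemma supnormD (f g : C01 R) : supnorm (f + g) <= supnorm f + supnorm g.
Proof.
apply: supnorm_le => t.
by rewrite (le_trans (ler_normD _ _))// lerD// ler_supnorm.
Qed.

Lemma supnormZ_le (a : R) (f : C01 R) : supnorm (a *: f) <= `|a| * supnorm f.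
Proof.
by apply: supnorm_le => t; rewrite normrZ ler_wpM2l// ler_supnorm.
Qed.

Lemma supnormZ (a : R) (f : C01 R) : supnorm (a *: f) = `|a| * supnorm f.
Proof.
apply/eqP; rewrite eq_le supnormZ_le/=.
have [->|a0] := eqVneq a 0.
  have [[_ [t _ _]] _] := supnorm_has_sup f.
  by rewrite normr0 mul0r (le_trans (normr_ge0 _) (ler_supnorm _ t)).
rewrite -ler_pdivlMl ?normr_gt0// -normfV.
by rewrite (le_trans _ (supnormZ_le _ _))// scalerA mulVf// scale1r.
Qed.

Lemma supnorm0_eq0 (f : C01 R) : supnorm f = 0 -> f = 0.
Proof.
move=> f0; apply/val_inj/funext => t /=; apply/eqP.
by rewrite -normr_le0 -f0 ler_supnorm.
Qed.

HB.instance Definition _ :=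
  Lmodule_isNormed.Build R (C01 R) supnormD supnormZ supnorm0_eq0.

Lemma C01_normE (f : C01 R) : `|f| = sup (range (fun t => `|f t|)).
Proof. by []. Qed.

End C01_normed.

Section BhatiaSemrl.
Context {R : realType}.

Definition birkhoff_orth {V : normedModType R} (x y : V) : Prop :=
  forall l : R, `|x| <= `|x + l *: y|.

Definition strong_orth {V : normedModType R} (x y : V) : Prop :=
  forall l : R, l != 0 -> `|x| < `|x + l *: y|.

Context {X Y : normedModType R}.

Definition norm_attainers (T : blop X Y) : set X :=
  [set x : X | `|x| = 1 /\ `|T x| = `|T|].

Definition norm_attaining : set (blop X Y) :=
  [set T | norm_attainers T !=set0].

Definition BS_adjusted : set (blop X Y) :=
  [set T | norm_attaining T /\
    forall S : blop X Y, strong_orth T S ->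
      exists x0 : X, norm_attainers T x0 /\ birkhoff_orth (T x0) (S x0)].

End BhatiaSemrl.
Arguments BS_adjusted {R} X Y.

(* Main.v *)
(** Write T as a signed measure. If its topological support contains a point p
    that is not an atom, then T is not in BS_a: the Dirac mass at p satisfies
    |T + l delta_p| = |T| + |l|, so T is strongly orthogonal to it, while every
    norm attainer f of T has |f p| = 1, so delta_p does not vanish on M_T.
    Hence the support of any T in BS_a consists of atoms and is countable, thus
    Lebesgue-null, which forces |T - Lebesgue| >= 1. Riesz representation is
    avoided: supports and atoms are expressed through the values of T on
    functions supported near a point. *)
Require Import Defs.
From mathcomp Require Import all_boot all_order all_algebra.
From mathcomp Require Import all_classical all_reals all_analysis.
From mathcomp Require Import ring lra.
Import numFieldNormedType.Exports.
Import Order.TTheory GRing.Theory Num.Theory.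

Set Implicit Arguments.
Unset Strict Implicit.
Unset Printing Implicit Defensive.

Local Open Scope classical_set_scope.
Local Open Scope ring_scope.

(** * Functions on the unit interval given by formulas *)

Section Localization.
Context {R : realType}.
Local Notation I := (`[0, 1]%classic : set R).
Implicit Types (f g : C01 R) (T : blop (C01 R) R^o) (t : I) (x p d e : R).

(** Total in [h]: a discontinuous [h] is sent to 0, so a function can be written down before its
    continuity is proved. *)
Definition C01_of (h : I -> R^o) : C01 R := insubd (0 : C01 R) h.

Lemma C01_ofE (h : I -> R^o) t : continuous h -> C01_of h t = h t.
Proof.
by move=> /continuous_predP ch; rewrite -[LHS]/(val (C01_of h) t) insubdK.
Qed.

Lemma continuous_set_val : continuous (set_val : I -> R).
Proof. exact: initial_continuous. Qed.

Definition mulC01 f (phi : R -> R) : C01 R :=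
  C01_of (fun t => f t * phi (\val t)).

Lemma mulC01E f phi t : continuous phi -> mulC01 f phi t = f t * phi (\val t).
Proof.
move=> cphi; apply: C01_ofE => s.
apply: (@cvgM _ _ _ _ (fun t => f t) _ (f s) _ (@C01_continuous _ f s)).
apply: (@continuous_comp _ _ _ (set_val : I -> R) phi); last exact: cphi.
exact: continuous_set_val.
Qed.

Lemma C01_continuous_at f t e : 0 < e ->
  exists2 d, 0 < d & forall s, `|\val s - \val t| < d -> `|f s - f t| < e.
Proof.
move=> e0; have := @C01_continuous _ f t.
move=> /(@cvgrPdist_lt _ R^o) /(_ e e0) [B [[C oC CB] Bt sB]].
have Ct : C (\val t) by move: Bt; rewrite -CB.
have /nbhs_ballP[d /= d0 dC] := open_nbhs_nbhs (conj oC Ct).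
exists d => // s st; rewrite distrC; apply: (sB s); rewrite -CB; apply: dC.
by rewrite -ball_normE /= distrC.
Qed.

(** * Support and atoms of a functional; behaviour of norm attainers on the support *)

Definition supported_in (p d : R) g := forall t, d <= `|\val t - p| -> g t = 0.

Definition support T : set R :=
  [set p | forall d, 0 < d -> exists2 g, supported_in p d g & T g != 0].

(** For the measure behind [T], every interval around [p] has total variation above [e]; as [d]
    shrinks, [p] is an atom of mass at least [e] in absolute value. *)
Definition atoms T (e : R) : set R :=
  [set p | forall d, 0 < d ->
    exists g, [/\ supported_in p d g, `|g| <= 1 & e < `|T g| ]].

Lemma C01_norm_le f (M : R) : (forall t, `|f t| <= M) -> `|f| <= M.
Proof. exact: supnorm_le. Qed.

Lemma C01_ler_norm f t : `|f t| <= `|f|.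
Proof. exact: ler_supnorm. Qed.

Lemma blop_ler_norm T f : `|f| <= 1 -> `|T f| <= `|T|.
Proof.
move=> f1; apply: le_trans (ler_opnorm T f) _.
by rewrite ler_piMr// opnorm_ge0.
Qed.

Lemma blopDZ T f g (b : R) : T (f + b *: g) = T f + b * T g.
Proof. by rewrite linearD linearZ. Qed.

(* If |f t| < 1, small local perturbations f + g and f - g stay in the unit ball,
   and T f is not extremal as soon as T g != 0. *)
Lemma norm_attainers_support T f t :
  support T (\val t) -> norm_attainers T f -> `|f t| = 1.
Proof.
move=> Tt [f1 Tf]; apply/eqP; rewrite eq_le -{1}f1 C01_ler_norm /=.
rewrite leNgt; apply/negP => ft1.
have [d d0 dP] : exists2 d, 0 < d & forall s, `|\val s - \val t| < d ->
    `|f s| <= (1 + `|f t|) / 2.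
  have [|d d0 dP] := @C01_continuous_at f t ((1 - `|f t|) / 2); first by lra.
  exists d => // s /dP; have := ler_normD (f s - f t) (f t).
  by rewrite subrK; lra.
have [g gd Tg] := Tt d d0.
have g0 : 0 < `|g|.
  by rewrite normr_gt0; apply: contra Tg => /eqP ->; rewrite linear0.
(* This makes the norm of [a *: g] equal to the room that the bound [dP] leaves below 1. *)
set a := (1 - `|f t|) / 2 / `|g|.
have a0 : 0 < a by rewrite divr_gt0//; lra.
have ab (b : R) : `|b| = a -> `|f + b *: g| <= 1.
  move=> ba; apply: C01_norm_le => s.
  change (`|f s + b * g s| <= 1).
  have [sd|sd] := ltP `|\val s - \val t| d; last first.
    by rewrite (gd _ sd) mulr0 addr0 -f1 C01_ler_norm.
  apply: le_trans (ler_normD _ _) _.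
  have : `|b * g s| <= (1 - `|f t|) / 2.
    rewrite normrM ba -[leRHS](@divfK _ `|g|) ?gt_eqF// ler_wpM2l ?(ltW a0)//.
    exact: C01_ler_norm.
  by have := dP s sd; lra.
(* Neither [T f + a * T g] nor [T f - a * T g] exceeds [T f] in absolute value, which forces
   [a * T g = 0]. *)
have := blop_ler_norm T (ab a (gtr0_norm a0)).
have := blop_ler_norm T (ab (- a) _); rewrite normrN => /(_ (gtr0_norm a0)).
rewrite !blopDZ -Tf mulNr.
set u := T f : R; set v := T g : R.
have : a * v != 0 by rewrite mulf_neq0// gt_eqF.
rewrite -normr_gt0; move: (a * v) => w {Tg}.
by rewrite !ler_norml; case: (ger0P u) => u0; case: (ger0P w) => w0 ?
  /andP[? ?] /andP[? ?]; lra.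
Qed.

(** * Dirac functionals at points without mass *)

Definition dirac_fun t f : R^o := f t.

Lemma dirac_fun_bounded t : dirac_fun t \in @bounded_linear R (C01 R) R^o.
Proof.
apply/bounded_linearP; split => //.
by exists 1 => f; rewrite mul1r; exact: C01_ler_norm.
Qed.

Definition diracC01 t : blop (C01 R) R^o := Blop (dirac_fun_bounded t).

Definition tent p d x : R := Num.max 0 (1 - `|x - p| / d).

Lemma continuous_tent p d : continuous (tent p d).
Proof.
move=> x; apply: (@continuous_max _ _ (cst 0) (fun x => 1 - `|x - p| / d)).
  exact: cvg_cst.
apply: cvgB; first exact: cvg_cst.
apply: cvgM; last exact: cvg_cst.
apply: cvg_norm; apply: cvgB; first exact: cvg_id.
exact: cvg_cst.
Qed.

Lemma tent_itv p d x : 0 < d -> 0 <= tent p d x <= 1.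
Proof.
move=> d0; rewrite /tent le_max lexx /= ge_max ler01 /= lerBlDr lerDl.
by rewrite divr_ge0// ltW.
Qed.

Lemma tent_center p d : tent p d p = 1.
Proof. by rewrite /tent subrr normr0 mul0r subr0; apply/max_idPr. Qed.

Lemma tent_out p d x : 0 < d -> d <= `|x - p| -> tent p d x = 0.
Proof.
by move=> d0 dx; apply/max_idPl; rewrite subr_le0 ler_pdivlMr// mul1r.
Qed.

Lemma norm_approx T e : 0 < e -> exists2 f, `|f| <= 1 & `|T| - e < T f.
Proof.
move=> e0; have [_ [f /= f1 <-] Tf] := sup_adherent e0 (opnorm_has_sup T).
have [Tf0|Tf0] := leP 0 (T f : R).
  by exists f => //; rewrite -(ger0_norm Tf0).
by exists (- f); rewrite ?normrN// linearN/= -(ltr0_norm Tf0).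
Qed.

Lemma blopDZE T (S : blop (C01 R) R^o) (b : R) f :
  (T + b *: S) f = T f + b * S f.
Proof. by []. Qed.

(* Near a point of zero mass, a nearly extremal f can be redefined to take any
   value at that point at negligible cost in T f. *)
Lemma dirac_strong_orth T t :
  (forall e, 0 < e -> ~ atoms T e (\val t)) -> strong_orth T (diracC01 t).
Proof.
move=> Tt l l0; suff : `|T| + `|l| <= `|T + l *: diracC01 t|.
  by apply: lt_le_trans; rewrite ltrDl normr_gt0.
apply/ler_addgt0Pr => e e0.
(* One third of [e] is lost in approximating the norm of [T], two thirds in the value of [T] at
   [2 *: g]. *)
have e3 : 0 < e / 3 by rewrite divr_gt0.
have [f f1 Tf] := norm_approx T e3.
have [d d0 dP] : exists2 d, 0 < d & forall g, supported_in (\val t) d g ->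
    `|g| <= 1 -> `|T g| <= e / 3.
  have /existsNP[d /not_implyP[d0 dP]] := Tt _ e3.
  exists d => // g gd g1; rewrite leNgt; apply/negP => Tg.
  by apply: dP; exists g.
pose s := Num.sg l.
have s1 : `|s| = 1 by rewrite normr_sg l0.
(* The factor 1/2 keeps [g] in the unit ball, so that [dP] applies. Then [f + 2 *: g] is a convex
   combination of [f] and the constant [s], weighted by the tent, with value [s] at [t]. *)
pose g := mulC01 (2^-1 *: (C01_of (cst s) - f)) (tent (\val t) d).
have gE u : g u = 2^-1 * (s - f u) * tent (\val t) d (\val u).
  rewrite mulC01E; last exact: continuous_tent.
  change (2^-1 * (C01_of (cst s) u - f u) * tent (\val t) d (\val u) =
    2^-1 * (s - f u) * tent (\val t) d (\val u)).
  rewrite C01_ofE//; exact: (@cst_continuous _ R^o).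
have fu u : `|f u| <= 1 by rewrite (le_trans (C01_ler_norm f u)).
have gd : supported_in (\val t) d g.
  by move=> u ud; rewrite gE tent_out// mulr0.
have g1 : `|g| <= 1.
  apply: C01_norm_le => u; rewrite gE.
  have /andP[b0 b1] := tent_itv (\val t) (\val u) d0.
  rewrite !normrM ger0_norm ?invr_ge0// (ger0_norm b0).
  have := ler_normB s (f u); rewrite s1 => h.
  apply: (@le_trans _ _ (2^-1 * 2 * 1)); last by lra.
  apply: ler_pM => //;
  by rewrite ler_pM2l//; have := fu u; lra.
have fg1 : `|f + 2 *: g| <= 1.
  apply: C01_norm_le => u; change (`|f u + 2 * g u| <= 1).
  rewrite gE; have := tent_itv (\val t) (\val u) d0.
  set b := tent _ _ _ => /andP[b0 b1].
  have -> : f u + 2 * (2^-1 * (s - f u) * b) = (1 - b) * f u + b * s by field.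
  apply: le_trans (ler_normD _ _) _.
  rewrite !normrM s1 mulr1 (ger0_norm b0) ger0_norm ?subr_ge0//.
  have : (1 - b) * `|f u| <= (1 - b) * 1 by rewrite ler_wpM2l ?subr_ge0.
  by lra.
have := blop_ler_norm (T + l *: diracC01 t) fg1.
rewrite blopDZE blopDZ (_ : diracC01 t _ = f t + 2 * g t)//.
rewrite gE tent_center.
have -> : l * (f t + 2 * (2^-1 * (s - f t) * 1)) = `|l|.
  by rewrite normrEsg /s; field.
move=> h; have := dP g gd g1; move: h.
set N := `|T + _|; set u := T f + _ + _ : R => h.
have := le_trans (ler_norm u) h; rewrite /u.
by rewrite ler_norml => h1 /andP[? ?]; lra.
Qed.

(** For scalars, Birkhoff orthogonality of [T f] to a nonzero [f t] forces [T f = 0]: take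
    [l = - (T f / f t)]. As [f] attains the norm, [T] is then zero and has empty support. *)
Lemma atoms_not_BS T t : support T (\val t) ->
  (forall e, 0 < e -> ~ atoms T e (\val t)) -> ~ BS_adjusted (C01 R) R^o T.
Proof.
move=> sT aT [_ /(_ _ (dirac_strong_orth aT))[f [fM]]].
have ft := norm_attainers_support sT fM.
have ft0 : f t != 0 by rewrite -normr_gt0 ft.
move=> /(_ (- (T f / f t))); have -> : T f + - (T f / f t) *: diracC01 t f = 0.
  by change (T f + - (T f / f t) * f t = 0 :> R); field.
rewrite normr0 fM.2 normr_le0 => /eqP T0.
have [g _ /eqP] := sT 1 ltr01; apply.
by rewrite T0.
Qed.

(** * Countability of the set of atoms *)

Lemma seq_separated (s : seq R) p : p \notin s ->
  exists2 d, 0 < d & forall q, q \in s -> d <= `|q - p|.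
Proof.
elim: s => [|q s IHs]; first by exists 1.
rewrite inE negb_or => /andP[pq /IHs[d d0 dP]].
exists (Num.min d `|q - p|) => [|r].
  by rewrite lt_min d0 normr_gt0 subr_eq0 eq_sym.
by rewrite inE ge_min => /predU1P[->|/dP ->//]; rewrite lexx orbT.
Qed.

(** Bumps around distinct atoms, disjoint and with signs making [T] positive, add up to a function
    still in the unit ball. The vanishing clause is what lets the induction keep the next bump
    disjoint from the earlier ones. *)
Lemma atoms_sum T e (s : seq R) d : uniq s -> {in s, forall p, atoms T e p} ->
  0 < d -> exists g, [/\ `|g| <= 1, e * (size s)%:R <= T g &
    forall u, (forall p, p \in s -> d <= `|\val u - p|) -> g u = 0].
Proof.
elim: s d => [|p s IHs] d.
  by move=> _ _ _; exists 0; split=> //; rewrite ?normr0 ?linear0 ?mulr0.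
move=> /= /andP[/seq_separated[r r0 rP] us] sT d0.
(* All points of [s] are at least [r] away from [p], so radius [r / 2] separates the new bump from
   the others; [d] gives the required vanishing. *)
pose c := Num.min d (r / 2).
have c0 : 0 < c by rewrite lt_min d0 divr_gt0.
have cd : c <= d by rewrite ge_min lexx.
have cr : c <= r / 2 by rewrite ge_min lexx orbT.
have [|g [g1 gT gs]] := IHs c us _ c0.
  by move=> q qs; apply: sT; rewrite inE qs orbT.
have [h [hp h1 hT]] : exists h, [/\ supported_in p c h, `|h| <= 1 & e < T h].
  have [h [hp h1 hT]] := sT p (mem_head _ _) c c0.
  have [Th|Th] := leP 0 (T h : R).
    by exists h; rewrite -(ger0_norm Th).
  exists (- h); rewrite normrN linearN/= -(ltr0_norm Th); split=> // u uc.
  by change (- h u = 0); rewrite hp// oppr0.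
exists (g + h); split.
- apply: C01_norm_le => u; change (`|g u + h u| <= 1).
  have [uc|uc] := leP c `|\val u - p|.
    by rewrite hp// addr0 (le_trans (C01_ler_norm g u)).
  rewrite gs ?add0r ?(le_trans (C01_ler_norm h u))// => q qs.
  have := rP q qs; have := ler_normD (q - \val u) (\val u - p).
  by rewrite addrA subrK (distrC q (\val u)); lra.
- rewrite linearD/= -natr1 mulrDr mulr1.
  by apply: lerD => //; exact: ltW.
- move=> u ud; change (g u + h u = 0); rewrite gs ?hp ?addr0//.
    by apply: le_trans cd _; apply: ud; rewrite mem_head.
  by move=> q qs; apply: le_trans cd _; apply: ud; rewrite inE qs orbT.
Qed.

(** More than [|T| / e] atoms would give, through [atoms_sum], a function in the unit ball at which
    [T] exceeds its norm. *)
Lemma finite_atoms T e : 0 < e -> finite_set (atoms T e).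
Proof.
move=> e0; apply: contrapT => iT.
have [B BT Bn] := infinite_set_fset (Num.truncn (`|T| / e)).+1 iT.
have [|g [g1 Tg _]] := @atoms_sum T e (finmap.enum_fset B) 1
  (finmap.fset_uniq B) _ ltr01.
  by move=> p pB; exact: BT.
have := le_trans (ler_norm _) (blop_ler_norm T g1).
apply/negP; rewrite -ltNge; apply: lt_le_trans Tg.
rewrite mulrC -ltr_pdivrMr//; apply: lt_le_trans (truncnS_gt _) _.
by rewrite ler_nat.
Qed.

Lemma ex_natSinv_lt e : 0 < e -> exists n, n.+1%:R^-1 < e.
Proof.
move=> e0; have [n _ nP] := near_infty_natSinv_lt (PosNum e0).
by exists n; exact: (nP n (leqnn n)).
Qed.

Lemma countable_atoms T : countable (\bigcup_(e in [set e | 0 < e]) atoms T e).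
Proof.
apply: (@sub_countable _ _ _ (\bigcup_n atoms T n.+1%:R^-1)); last first.
  apply: bigcup_countable => // n _; apply/finite_set_countable/finite_atoms.
  by rewrite invr_gt0.
apply: subset_card_le => p [e /= e0 Tp].
have [n ne] := ex_natSinv_lt e0.
exists n => // d /Tp[g [gd g1 Tg]]; exists g; split=> //.
exact: lt_trans Tg.
Qed.

(** * From local to global vanishing *)

Definition clamp x : R := Num.max 0 (Num.min 1 x).

Lemma continuous_clamp : continuous clamp.
Proof.
move=> x; apply: (@continuous_max _ _ (cst 0) (fun x => Num.min 1 x)).
  exact: cvg_cst.
apply: (@continuous_min _ _ (cst 1) (fun x => x)); first exact: cvg_cst.
exact: cvg_id.
Qed.

Lemma clamp0 x : x <= 0 -> clamp x = 0.
Proof. by move=> x0; apply/max_idPl; rewrite ge_min x0 orbT. Qed.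

Lemma clamp1 x : 1 <= x -> clamp x = 1.
Proof. by move=> x1; rewrite /clamp (min_idPl x1); apply/max_idPr. Qed.

Lemma clamp_itv x : 0 <= clamp x <= 1.
Proof. by rewrite /clamp le_max lexx /= ge_max ler01 ge_min lexx. Qed.

Lemma C01P f g : (forall t, f t = g t) -> f = g.
Proof. by move=> fg; apply/val_inj/funext. Qed.

(* A Lebesgue number 1/N for the given local data makes T kill each term of the
   partition of unity [r k - r k.+1], k <= N, where r 0 = 1 and r N.+1 = 0. *)
Lemma blop_local0 T f :
  (forall x, I x -> exists2 d, 0 < d & forall phi : R -> R, continuous phi ->
    (forall y, d <= `|y - x| -> phi y = 0) -> T (mulC01 f phi) = 0) ->
  T f = 0.
Proof.
move=> locT.
pose P (d : R) x := forall phi : R -> R, continuous phi ->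
  (forall y, d <= `|y - x| -> phi y = 0) -> T (mulC01 f phi) = 0.
(* Compactness yields one radius for all points: if [y] is within [d / 2] of [x] and [c < d / 2],
   the interval of radius [c] at [y] lies in that of radius [d] at [x]. *)
have : \forall d \near 0^'+, I `<=` P d.
  apply: ((compact_near_coveringP I).1 (@segment_compact _ 0 1)).
  move=> x /locT[d d0 dP].
  have d20 : 0 < d / 2 by rewrite divr_gt0.
  exists (ball x (d / 2), [set c | c < d / 2]) => /=.
    by split; [exact: nbhsx_ballx | exact: nbhs_right_lt].
  move=> [y c] [/= yx cd] phi cphi phiy; apply: dP => // z zx.
  apply: phiy; move: yx; rewrite -ball_normE /=.
  by have := ler_normD (z - y) (y - x); rewrite addrA subrK (distrC x y); lra.
case=> e /= e0 eP.
have [n ne] := ex_natSinv_lt e0.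
pose N : R := n.+1%:R.
have N0 : 0 < N by rewrite ltr0n.
have PN : I `<=` P N^-1.
  apply: eP; rewrite ?invr_gt0//= sub0r normrN gtr0_norm// invr_gt0//.
(* [r k] rises linearly from 0 to 1 between [(k - 1) / N] and [k / N], so [r k - r k.+1] is the tent
   of radius [1 / N] at [k / N]. Since [N] is [n.+1], the function that vanishes on [I] is
   [r n.+2]. *)
pose r (k : nat) x := clamp (N * x - k%:R + 1).
have cr k : continuous (r k).
  move=> x.
  apply: (@continuous_comp _ _ _ (fun x => N * x - k%:R + 1) clamp); last first.
    exact: continuous_clamp.
  apply: cvgD; last exact: cvg_cst.
  apply: cvgB; last exact: cvg_cst.
  apply: cvgM; first exact: cvg_cst.
  exact: cvg_id.
have Tr k : (k <= n.+1)%N -> T (mulC01 f (r k)) = T (mulC01 f (r k.+1)).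
  move=> kn.
  have cphi : continuous (fun x => r k x - r k.+1 x).
    by move=> x; apply: cvgB; exact: cr.
  have : T (mulC01 f (fun x => r k x - r k.+1 x)) = 0.
    apply: (PN (k%:R / N)) => //.
      by rewrite /= in_itv/= divr_ge0 ?ler_pdivrMr ?mul1r ?ler_nat// ltW.
    move=> y; have -> : y - k%:R / N = (N * y - k%:R) / N.
      by field; rewrite gt_eqF.
    rewrite normrM normfV (gtr0_norm N0) -[leLHS]mul1r ler_pM2r ?invr_gt0//.
    rewrite /r -natr1; case: ger0P => ? ?.
      by rewrite !clamp1 ?subrr//; lra.
    by rewrite !clamp0 ?subrr//; lra.
  have -> : mulC01 f (fun x => r k x - r k.+1 x) =
      mulC01 f (r k) - mulC01 f (r k.+1).
    apply: C01P => t.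
    rewrite -[RHS]/(mulC01 f (r k) t - mulC01 f (r k.+1) t).
    by rewrite !mulC01E// mulrBr.
  by rewrite linearB/= => /eqP; rewrite subr_eq0 => /eqP.
have rT k : (k <= n.+2)%N -> T (mulC01 f (r k)) = T (mulC01 f (r 0%N)).
  by elim: k => // k IHk kn; rewrite -Tr// IHk// ltnW.
have -> : f = mulC01 f (r 0%N).
  apply: C01P => t; rewrite mulC01E// /r clamp1 ?mulr1//.
  have := set_valP t; rewrite /= in_itv/= => /andP[t0 _].
  by rewrite subr0 lerDr mulr_ge0// ltW.
have r0 x : x <= 1 -> N * x - n.+2%:R + 1 <= 0.
  move=> x1; rewrite -natr1 -/N; have : N * x <= N * 1 by rewrite ler_pM2l.
  by lra.
rewrite -(rT n.+2)// (_ : mulC01 f _ = 0) ?linear0//.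
apply: C01P => t; rewrite mulC01E// /r clamp0 ?mulr0//.
have := set_valP t; rewrite /= in_itv/= => /andP[_ t1].
by exact: r0.
Qed.

(** * The Lebesgue integral as a functional *)

Definition ext f : R -> R := valL (C01_fun f).

Lemma extE f t : ext f (\val t) = f t.
Proof. by rewrite -[in RHS](@valLK _ _ (point : R^o) I (C01_fun f)). Qed.

Lemma extDZ (b : R) f g x : I x -> ext (b *: f + g) x = b * ext f x + ext g x.
Proof.
by move=> /mem_set Ix; rewrite -[x]/(\val (exist _ x Ix : I)) !extE.
Qed.

Lemma integrable_ext f : lebesgue_measure.-integrable I (EFin \o ext f).
Proof.
apply: continuous_compact_integrable; first exact: segment_compact.
by apply/subspace_valL_continuousP; exact: C01_continuous.
Qed.

Definition lebesgue_fun f : R^o := (\int[lebesgue_measure]_(x in I) ext f x)%R.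

Lemma lebesgue_fun_bounded : lebesgue_fun \in @bounded_linear R (C01 R) R^o.
Proof.
have mI : measurable (I : set (measurableTypeR R)) by exact: measurable_itv.
apply/bounded_linearP; split.
  move=> b f g; rewrite /lebesgue_fun.
  transitivity (\int[lebesgue_measure]_(x in I) (b * ext f x + ext g x))%R.
    by apply: eq_Rintegral => x; rewrite inE => /extDZ ->.
  have ib : lebesgue_measure.-integrable I (EFin \o (fun x => b * ext f x)).
    exact: (integrableZl mI b (integrable_ext f)).
  rewrite RintegralD//; last exact: integrable_ext.
  by rewrite RintegralZl//; exact: integrable_ext.
exists 1 => f; rewrite mul1r /lebesgue_fun.
apply: le_trans (le_normr_Rintegral mI (integrable_ext f)) _.
have -> : `|f| = \int[lebesgue_measure]_(x in I) `|f|.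
  rewrite Rintegral_cst//= lebesgue_measure_itv/= lte_fin ltr01.
  by rewrite -EFinD subr0 mulr1.
apply: le_Rintegral => //.
- exact: (integrable_norm (integrable_ext f)).
- apply: continuous_compact_integrable; first exact: segment_compact.
  by apply: continuous_subspaceT => x; exact: cvg_cst.
- move=> x /mem_set Ix.
  by rewrite -[x]/(\val (exist _ x Ix : I)) extE C01_ler_norm.
Qed.

Definition lebesgueC01 : blop (C01 R) R^o := Blop lebesgue_fun_bounded.

(** * Distance to a set, and functionals close to the Lebesgue integral *)

Definition dist (K : set R) x : R := inf [set `|x - k| | k in K].

Lemma has_inf_dist K x : K !=set0 -> has_inf [set `|x - k| | k in K].
Proof.
by move=> [k Kk]; split; [exists `|x - k|, k | exists 0 => _ [? _ <-]].
Qed.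

Lemma dist_le K x k : K k -> dist K x <= `|x - k|.
Proof.
move=> Kk; apply: ge_inf; last by exists k.
exact: (has_inf_dist x (ex_intro _ k Kk)).2.
Qed.

Lemma dist_lip K x y : K !=set0 -> `|dist K x - dist K y| <= `|x - y|.
Proof.
move=> K0; wlog xy : x y / dist K y <= dist K x => [H|].
  case: (leP (dist K y) (dist K x)) => [/H//|/ltW/H].
  by rewrite distrC (distrC x).
rewrite ger0_norm ?subr_ge0// lerBlDr -lerBlDl.
apply: lb_le_inf; first exact: (has_inf_dist y K0).1.
move=> _ [k Kk <-]; rewrite lerBlDl; apply: le_trans (dist_le x Kk) _.
by rewrite -(subrKA y) ler_normD.
Qed.

Lemma continuous_dist K : K !=set0 -> continuous (dist K).
Proof.
move=> K0 x; apply/(@cvgrPdist_lt _ R^o) => e e0; near=> y.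
apply: le_lt_trans (dist_lip x y K0) _.
near: y; exact: (@cvgr_dist_lt _ R^o).
Unshelve. all: by end_near. Qed.

Lemma dist_adherent K x e : K !=set0 -> dist K x < e ->
  exists2 k, K k & `|x - k| < e.
Proof.
move=> K0 xe; have e0 : 0 < e - dist K x by rewrite subr_gt0.
have [_ [k Kk <-]] := inf_adherent e0 (has_inf_dist x K0).
by rewrite -/(dist K x) => xk; exists k => //; lra.
Qed.

(** Otherwise the support of [T] is countable. Functions in the unit ball vanishing near the support
    are killed by [T], yet they can converge to 1 almost everywhere, so that their integrals tend to
    1. *)
Lemma near_lebesgue_atoms T : `|T - lebesgueC01| < 1 ->
  exists2 t : I, support T (\val t) & forall e, 0 < e -> ~ atoms T e (\val t).
Proof.
move=> Tleb; apply: contrapT => noT.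
have suppA : I `&` support T `<=` \bigcup_(e in [set e | 0 < e]) atoms T e.
  move=> x [/mem_set Ix Tx]; apply: contrapT => xA; apply: noT.
  by exists (exist _ x Ix) => // e e0 ex; apply: xA; exists e.
(* Adding 0 only ensures that the distance to K is not junk. *)
pose K := 0 |` (I `&` support T).
have K0 : K !=set0 by exists 0; left.
have cK : countable K.
  rewrite /K -bigcup2E; apply: bigcup_countable => // -[|[|n]] _ //=.
  exact: sub_countable (subset_card_le suppA) (countable_atoms T).
(* Zero within [1 / n.+1] of [K], and 1 from distance [2 / n.+1] on. *)
pose phi n x := clamp (n.+1%:R * dist K x - 1).
have cphi n : continuous (phi n).
  move=> x.
  apply: (@continuous_comp _ _ _ (fun x => n.+1%:R * dist K x - 1) clamp).
    apply: cvgB; last exact: cvg_cst.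
    by apply: cvgM; [exact: cvg_cst | exact: continuous_dist].
  exact: continuous_clamp.
pose f n := mulC01 (C01_of (cst 1)) (phi n).
have fE n t : f n t = phi n (\val t).
  by rewrite mulC01E// C01_ofE ?mul1r//; exact: (@cst_continuous _ R^o).
(* Locally, either [x] is in [K] and [f n] vanishes near [x], or [x] is off the support and [T]
   kills everything supported near [x]. *)
have Tf n : T (f n) = 0.
  apply: blop_local0 => x Ix.
  have [Kx|Kx] := pselect (K x).
    exists n.+1%:R^-1 => [|psi cpsi psix]; first by rewrite invr_gt0.
    rewrite (_ : mulC01 _ _ = 0) ?linear0//; apply: C01P => t.
    rewrite mulC01E// fE; have [tx|tx] := leP n.+1%:R^-1 `|\val t - x|.
      by rewrite psix// mulr0.
    rewrite /phi clamp0 ?mul0r// subr_le0 mulrC -ler_pdivlMr// mul1r.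
    exact: le_trans (dist_le _ Kx) (ltW tx).
  have /existsNP[d /not_implyP[d0 dP]] : ~ support T x.
    by move=> Tx; apply: Kx; right.
  exists d => // psi cpsi psix; apply/eqP/negP => Tpsi; apply: dP.
  exists (mulC01 (f n) psi); last exact/negP.
  by move=> t td; rewrite mulC01E// psix// mulr0.
pose M := `|T - lebesgueC01|.
have lebf n : lebesgue_fun (f n) <= M.
  have f1 : `|f n| <= 1.
    apply: C01_norm_le => t; rewrite fE.
    have /andP[? ?] := clamp_itv (n.+1%:R * dist K (\val t) - 1).
    by rewrite ger0_norm.
  have := blop_ler_norm (T - lebesgueC01) f1.
  rewrite -[(T - _) _]/(T (f n) - lebesgue_fun (f n)) Tf sub0r normrN.
  by apply: le_trans; exact: ler_norm.
(* Points off [K] have positive distance to it because the support is closed: a support point within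
   [d / 2] of [x] would give a function supported within [d] of [x] that [T] does not kill. The
   bound [|x|] handles the added point 0. *)
have phi1 x : I x -> ~ K x -> \forall n \near \oo, phi n x = 1.
  move=> Ix Kx; have [c c0 cx] : exists2 c, 0 < c & c <= dist K x.
    have /existsNP[d /not_implyP[d0 dP]] : ~ support T x.
      by move=> Tx; apply: Kx; right.
    have x0 : 0 < `|x|.
      by rewrite normr_gt0; apply/eqP => x0; apply: Kx; left.
    exists (Num.min (d / 2) `|x|); first by rewrite lt_min x0 divr_gt0.
    rewrite leNgt; apply/negP => /(dist_adherent K0)[k [->|[_ Tk]]].
      by rewrite subr0 lt_min ltxx andbF.
    rewrite lt_min => /andP[xk _].
    have d20 : 0 < d / 2 by rewrite divr_gt0.
    have [g gk Tg] := Tk (d / 2) d20; apply: dP.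
    exists g => // t td; apply: gk.
    by have := ler_normD (\val t - k) (k - x); rewrite subrKA (distrC k x); lra.
  near=> n; apply: clamp1.
  rewrite lerBrDr -ler_pdivrMr ?(lt_le_trans c0 cx)//.
  apply: (@le_trans _ _ (2 / c)).
    by rewrite ler_pM2l// lef_pV2 ?posrE// (lt_le_trans c0 cx).
  apply: (@le_trans _ _ n%:R); last by rewrite ler_nat.
  near: n; exact: nbhs_infty_ger.
have mI : measurable (I : set (measurableTypeR R)) by exact: measurable_itv.
have ifn n : lebesgue_measure.-integrable I (EFin \o phi n).
  apply: continuous_compact_integrable; first exact: segment_compact.
  by apply: continuous_subspaceT => x; exact: cphi.
have leb_phi n : lebesgue_fun (f n) = \int[lebesgue_measure]_(x in I) phi n x.
  apply: eq_Rintegral => x xI.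
  by rewrite -[x]/(\val (exist _ x xI : I)) extE fE.
have := @dominated_convergence _ _ _ lebesgue_measure I mI
  (fun n => EFin \o phi n) (cst 1%E) (cst 1%E).
case.
- by move=> n; exact: measurable_int (ifn n).
- exact: measurable_cst.
- exists K; split.
  + by apply: countable_measurable => // x; exact: measurable_set1.
  + exact: countable_lebesgue_measure0.
  + move=> x /= nx; apply: contrapT => Kx; apply: nx => Ix.
    by apply: cvg_near_cst; apply: filterS (phi1 x Ix Kx) => n /= ->.
- apply: continuous_compact_integrable; first exact: segment_compact.
  by apply: continuous_subspaceT => x; exact: cvg_cst.
- apply: aeW => x n _ /=; rewrite lee_fin.
  by have /andP[? ?] := clamp_itv (n.+1%:R * dist K x - 1); rewrite ger0_norm.
move=> _ _ /= h.
(* The integrals of [phi n] are at most [M] and tend to the length 1 of [I], so [1 <= M]. *)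
have := Tleb; apply/negP; rewrite -leNgt -/M -lee_fin.
have <- : (\int[lebesgue_measure]_(x in I) cst 1 x)%E = 1%E :> \bar R.
  rewrite integral_cst//= lebesgue_measure_itv/= lte_fin ltr01.
  by rewrite -EFinD subr0 mule1.
rewrite -(cvg_lim _ h)//; apply: lime_le.
  by apply/cvg_ex; eexists; exact: h.
apply: nearW => n; rewrite -[leLHS]fineK ?integrable_fin_num//; last exact: ifn.
by rewrite lee_fin -[leLHS]/(\int[lebesgue_measure]_(x in I) phi n x) -leb_phi.
Unshelve. all: by end_near. Qed.

End Localization.

Theorem theorem2p21 (R : realType) :
  ~ dense (BS_adjusted (C01 R) R^o).
Proof.
(* The open unit ball around the Lebesgue functional misses [BS_adjusted] altogether. *)
have leb1 : ball (@lebesgueC01 R) 1 !=set0.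
  by exists lebesgueC01; exact: ballxx.
move=> /(_ _ leb1 (ball_open _ _))[T []].
rewrite -ball_normE /= distrC => /near_lebesgue_atoms[t Tt aT].
exact: (atoms_not_BS Tt aT).
Qed.
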